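(* For any graph $H$, if $1 - \frac{1}{|E(H)|} < p < 1$, there exists a graph $G$ with $\chi(G) = \chi(H)$ such that $\mathbb{E}[\chi(H_p)] > \mathbb{E}[\chi(G_p)]$.
   Context: $\chi$ denotes the chromatic number and $E(H)$ the edge set of $H$. For a graph $G$ and $p\in[0,1]$, $G_p$ denotes the random subgraph of $G$ obtained by keeping each edge of $G$ independently with probability $p$.
   Formalization: H is assumed to have at least two edges: for |E(H)| = 0 the bound 1/|E(H)| is undefined, and for |E(H)| = 1 the claim fails, since E[χ(H_p)] = 1 + p while every G with χ(G) = 2 has E[χ(G_p)] = 2 − (1−p)^{|E(G)|} ≥ 1 + p. *)

(* Defs.v *)
From HB Require Import structures.
From mathcomp Require Import all_boot all_order all_algebra.
From mathcomp Require Import reals.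

Set Implicit Arguments.
Unset Strict Implicit.
Unset Printing Implicit Defensive.

Import Order.TTheory GRing.Theory Num.Theory.
Local Open Scope ring_scope.

Record sgraph := SGraph {
  vertex :> finType;
  adj : rel vertex;
  adj_sym : symmetric adj;
  adj_irr : irreflexive adj }.

(* An edge is the unordered pair [set x; y] of its (distinct) endpoints. *)
Definition edges (G : sgraph) : {set {set G}} :=
  [set e : {set G} | [exists x, exists y, adj x y && (e == [set x; y])]].

Definition colorable (G : sgraph) (k : nat) : bool :=
  [exists f : {ffun G -> 'I_k}, [forall x, forall y, adj x y ==> (f x != f y)]].

Lemma colorable_card (G : sgraph) : exists k, colorable G k.
Proof.
exists #|G|; apply/existsP; exists [ffun x => enum_rank x].
apply/forallP=> x; apply/forallP=> y; apply/implyP=> xy.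
rewrite !ffunE; apply: contraTneq xy => /enum_rank_inj ->.
by rewrite adj_irr.
Qed.

Definition chromatic_number (G : sgraph) : nat := ex_minn (colorable_card G).

Section SpanningSubgraph.
Variables (G : sgraph) (S : {set {set G}}).

Definition sub_adj : rel G := fun x y => adj x y && ([set x; y] \in S).

Lemma sub_adj_sym : symmetric sub_adj.
Proof. by move=> x y; rewrite /sub_adj adj_sym setUC. Qed.

Lemma sub_adj_irr : irreflexive sub_adj.
Proof. by move=> x; rewrite /sub_adj adj_irr. Qed.

(* Same vertex set as G; the edges are those of G that lie in S. *)
Definition spanning_subgraph : sgraph := SGraph sub_adj_sym sub_adj_irr.

End SpanningSubgraph.

(* Law of the random subgraph G_p on the subsets S of the edge set of G: the
   product of Bernoulli(p) laws over the edges, i.e. the probability that S is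
   exactly the set of edges kept. *)
Definition kept_prob (R : realType) (p : R) (G : sgraph) (S : {set {set G}}) : R :=
  \prod_(e in edges G) (if e \in S then p else 1 - p).

Definition expectation_Gp (R : realType) (p : R) (G : sgraph)
    (X : sgraph -> R) : R :=
  \sum_(S in powerset (edges G)) kept_prob p S * X (spanning_subgraph S).

Definition expected_chi (R : realType) (p : R) (G : sgraph) : R :=
  expectation_Gp p G (fun F => (chromatic_number F)%:R).

(* Main.v *)
(* Let k = chi(H) and m = |E(H)|. Restoring a deleted edge raises the chromatic
   number by at most 1, so E[chi(H_p)] >= k - m (1 - p) > k - 1. Conversely, if
   chi(G) = k and deleting any one edge of a set F makes G (k - 1)-colorable,
   then E[chi(G_p)] <= k - 1 + p^|F|. For k >= 3, iterated cones over long odd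
   cycles have such an F of any size. For k = 2 such a G has a single edge, so
   |F| = 1, and the sharper bound E[chi(H_p)] >= 2 - (1 - p)^m > 1 + p is
   needed; this is where m > 1 enters. *)
Require Import Defs.
From HB Require Import structures.
From mathcomp Require Import all_boot all_order all_algebra.
From mathcomp Require Import reals.
From mathcomp Require Import zify lra.

Set Implicit Arguments.
Unset Strict Implicit.
Unset Printing Implicit Defensive.

Import Order.TTheory GRing.Theory Num.Theory.
Local Open Scope ring_scope.

(** * Colourings with natural-number colours, and edge deletion *)

(** Taking a bare relation lets an edge be deleted without rebuilding an [sgraph]; colours in [nat]
    allow arithmetic on palettes. *)
Definition rel_colorable {T : Type} (r : rel T) (k : nat) : Prop :=
  exists f : T -> nat, (forall x, f x < k)%N /\ forall x y, r x y -> f x != f y.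

Lemma rel_colorable_sub (T : Type) (r s : rel T) (k : nat) :
  subrel r s -> rel_colorable s k -> rel_colorable r k.
Proof. by move=> rs [f [fk fs]]; exists f; split=> // x y /rs/fs. Qed.

Lemma rel_colorable_leq (T : Type) (r : rel T) (j k : nat) :
  (j <= k)%N -> rel_colorable r j -> rel_colorable r k.
Proof.
by move=> jk [f [fj fs]]; exists f; split=> // x; apply: leq_trans (fj x) jk.
Qed.

Lemma colorableP (G : sgraph) (k : nat) :
  reflect (rel_colorable (@adj G) k) (colorable G k).
Proof.
apply: (iffP existsP) => [[f /forallP fP]|[f [fk fP]]].
  exists (fun x => nat_of_ord (f x)); split=> // x y xy.
  have /forallP/(_ y)/implyP/(_ xy) := fP x.
  by apply: contra => /eqP/val_inj ->.
exists [ffun x => Ordinal (fk x)].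
apply/forallP=> x; apply/forallP=> y; apply/implyP=> /fP.
by rewrite !ffunE; apply: contra => /eqP[->].
Qed.

Lemma chromatic_number_leP (G : sgraph) (k : nat) :
  reflect (rel_colorable (@adj G) k) (chromatic_number G <= k)%N.
Proof.
rewrite /chromatic_number; case: ex_minnP => m /colorableP mP mmin.
apply: (iffP idP) => [mk|/colorableP/mmin //].
exact: rel_colorable_leq mk mP.
Qed.

Lemma edgesP (G : sgraph) (e : {set G}) :
  reflect (exists x y, adj x y /\ e = [set x; y]) (e \in edges G).
Proof.
rewrite inE; apply: (iffP existsP) => [[x /existsP[y /andP[xy /eqP ->]]]|].
  by exists x, y.
by case=> x [y [xy ->]]; exists x; apply/existsP; exists y; rewrite xy eqxx.
Qed.

Lemma mem_edges (G : sgraph) (x y : G) : adj x y -> [set x; y] \in edges G.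
Proof. by move=> xy; apply/edgesP; exists x, y. Qed.

Lemma chromatic_number_edge (G : sgraph) (e : {set G}) :
  e \in edges G -> (1 < chromatic_number G)%N.
Proof.
case/edgesP=> x [y [xy _]]; rewrite ltnNge.
apply/chromatic_number_leP => -[f [f1 fP]].
by move: (fP _ _ xy) (f1 x) (f1 y); lia.
Qed.

(* Recolour one endpoint of each deleted edge with a private new colour. *)
Lemma chromatic_number_spanning_subgraph (G : sgraph) (S : {set {set G}}) :
  (chromatic_number G <=
     chromatic_number (spanning_subgraph S) + #|edges G :\: S|)%N.
Proof.
have /chromatic_number_leP[f [fk fP]] :=
  leqnn (chromatic_number (spanning_subgraph S)).
set c := chromatic_number _ in fk *.
pose V := pmap (fun e : {set G} => [pick x in e]) (enum (edges G :\: S)).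
have szV : (size V <= #|edges G :\: S|)%N.
  by rewrite size_pmap cardE; apply: count_size.
apply/chromatic_number_leP.
exists (fun x => if x \in V then (c + index x V)%N else f x).
split=> [x|x y xy].
  case: ifP => [xV|_]; last exact: ltn_addr.
  by rewrite ltn_add2l (leq_trans _ szV) // index_mem.
case: ifPn => xV; case: ifPn => yV.
- rewrite eqn_add2l; apply: contraTneq xy => /(congr1 (nth x V)).
  by rewrite !nth_index // => ->; rewrite adj_irr.
- by have := fk y; lia.
- by have := fk x; lia.
(* An edge with no endpoint in [V] was kept: a deleted one has its picked endpoint in [V]. *)
- apply: fP; rewrite /= /sub_adj xy /=; apply/negPn/negP => xyS.
  have: [set x; y] \in enum (edges G :\: S)
    by rewrite mem_enum inE xyS mem_edges.
  move/(map_f (fun e : {set G} => [pick x in e])).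
  case: pickP => [z|/(_ x)]; last by rewrite !inE eqxx.
  by rewrite !inE -mem_pmap => /orP[/eqP->|/eqP->]; apply/negP.
Qed.

(** * Expectations under the product law of the kept edges *)

Section Expectation.
Context {R : realType} (p : R) (G : sgraph).

(** Independence of the edges: expanding the right-hand product chooses, for each edge, the kept or
    the deleted term. *)
Lemma expectation_prod (c d : {set G} -> R) :
  \sum_(S in powerset (edges G))
     kept_prob p S * \prod_(e in edges G) (if e \in S then c e else d e)
  = \prod_(e in edges G) (p * c e + (1 - p) * d e).
Proof.
(* Off the edge set the factor [a e + b e] is 1, and [a e = 0] kills every [S] that contains a
   non-edge, so the sum may range over all sets. *)
pose a e := if e \in edges G then p * c e else 0.
pose b e := if e \in edges G then (1 - p) * d e else 1.
have -> : \prod_(e in edges G) (p * c e + (1 - p) * d e) = \prod_e (a e + b e).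
  rewrite big_mkcond /=; apply: eq_bigr => e _; rewrite /a /b.
  by case: ifP => // _; rewrite add0r.
rewrite bigA_distr /= big_mkcond /= [RHS]big_mkcond /=; apply: eq_bigr => S _.
rewrite powersetE; case: ifPn => [SE|/subsetPn[e eS eE]]; last first.
  by rewrite (bigD1 e) //= eS /a (negPf eE) mul0r.
rewrite /kept_prob -big_split /= big_mkcond /=; apply: eq_bigr => e _.
rewrite /a /b; case: ifPn => eE; first by case: ifP.
by rewrite (contraNF (subsetP SE e) eE).
Qed.

Lemma kept_prob_sum :
  \sum_(S in powerset (edges G)) kept_prob p S = 1.
Proof.
transitivity (\prod_(e in edges G) (p * 1 + (1 - p) * 1)).
  rewrite -expectation_prod; apply: eq_bigr => S _.
  by rewrite big1 ?mulr1 // => e _; case: ifP.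
by rewrite big1 // => e _; rewrite !mulr1 addrC subrK.
Qed.

Lemma kept_prob_contains (F : {set {set G}}) : F \subset edges G ->
  \sum_(S in powerset (edges G)) kept_prob p S * (F \subset S)%:R = p ^+ #|F|.
Proof.
move=> FE.
(* The indicator of [F \subset S] is a product over edges: a deleted edge contributes 0 exactly when
   it lies in [F]. *)
transitivity (\prod_(e in edges G) (p * 1 + (1 - p) * (e \notin F)%:R)).
  rewrite -expectation_prod; apply: eq_bigr => S _; congr (_ * _).
  case: (boolP (F \subset S)) => [FS|/subsetPn[e eF eS]].
    rewrite big1 // => e _; case: ifPn => // eS.
    by rewrite (contra (subsetP FS e) eS).
  by rewrite (bigD1 e) ?(subsetP FE) //= (negPf eS) eF mul0r.
rewrite (big_setID F) /= (setIidPr FE) [X in _ * X]big1 ?mulr1; last first.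
  by move=> e /setDP[_ eF]; rewrite eF /= !mulr1 addrC subrK.
under eq_bigr => e eF do rewrite eF mulr0 addr0.
by rewrite prodr_const.
Qed.

Lemma kept_prob_deleted (e : {set G}) : e \in edges G ->
  \sum_(S in powerset (edges G)) kept_prob p S * (e \notin S)%:R = 1 - p.
Proof.
move=> eE; have := @kept_prob_contains [set e].
rewrite sub1set cards1 expr1 => /(_ eE) pE.
transitivity (\sum_(S in powerset (edges G))
    (kept_prob p S - kept_prob p S * ([set e] \subset S)%:R)).
  apply: eq_bigr => S _; rewrite sub1set.
  by case: (e \in S); rewrite /= ?mulr0 ?mulr1 ?subrr ?subr0.
by rewrite sumrB kept_prob_sum pE.
Qed.

Lemma kept_prob_set0 : kept_prob p (G := G) set0 = (1 - p) ^+ #|edges G|.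
Proof.
rewrite /kept_prob -prodr_const; apply: eq_bigr => e _.
by rewrite inE.
Qed.

(** Linearity of expectation, with the number of deleted edges written as a sum of indicators. *)
Lemma expected_deleted :
  \sum_(S in powerset (edges G)) kept_prob p S * #|edges G :\: S|%:R
  = #|edges G|%:R * (1 - p).
Proof.
transitivity (\sum_(e in edges G) (1 - p)); last first.
  by rewrite sumr_const mulr_natl.
rewrite -(eq_bigr _ kept_prob_deleted) exchange_big /=.
apply: eq_bigr => S _; rewrite -mulr_sumr -natr_sum; congr (_ * _%:R).
rewrite -sum1_card big_mkcond [RHS]big_mkcond /=; apply: eq_bigr => e _.
by rewrite inE; case: (e \in S); case: (e \in edges G).
Qed.

Hypothesis p01 : 0 <= p <= 1.

Lemma kept_prob_ge0 (S : {set {set G}}) : 0 <= kept_prob p S.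
Proof.
have /andP[p0 p1] := p01; apply: prodr_ge0 => e _.
by case: ifP; rewrite ?subr_ge0.
Qed.

(** Reduces each bound on an expectation to a pointwise one; [c] comes out because the total mass is
    1. *)
Lemma ler_expectation_Gp (c : R) (f X : {set {set G}} -> R) :
  (forall S : {set {set G}}, S \subset edges G -> c + f S <= X S) ->
  c + \sum_(S in powerset (edges G)) kept_prob p S * f S
    <= \sum_(S in powerset (edges G)) kept_prob p S * X S.
Proof.
move=> fX; rewrite -[c]mul1r -kept_prob_sum mulr_suml -big_split /=.
apply: ler_sum => S; rewrite powersetE => /fX SX.
by rewrite -mulrDr ler_wpM2l // kept_prob_ge0.
Qed.

Lemma expected_chi_ge_deleted :
  (chromatic_number G)%:R - #|edges G|%:R * (1 - p) <= expected_chi p G.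
Proof.
rewrite -expected_deleted -sumrN.
under eq_bigr => S _ do rewrite -mulrN.
apply: ler_expectation_Gp => S _; rewrite lerBlDr -natrD ler_nat.
exact: chromatic_number_spanning_subgraph.
Qed.

Lemma expected_chi_ge_edgeless : (0 < #|edges G|)%N ->
  2 - (1 - p) ^+ #|edges G| <= expected_chi p G.
Proof.
move=> /card_gt0P[e0 e0E].
have -> : (1 - p) ^+ #|edges G|
    = \sum_(S in powerset (edges G)) kept_prob p S * (S == set0)%:R.
  rewrite (bigD1 set0) ?powersetE ?sub0set //= eqxx mulr1 kept_prob_set0.
  by rewrite big1 ?addr0 // => S /andP[_ /negPf->]; rewrite mulr0.
rewrite -sumrN.
under eq_bigr => S _ do rewrite -mulrN.
apply: ler_expectation_Gp => S SE; rewrite lerBlDr -natrD ler_nat.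
case: eqVneq => [->|/set0Pn[e eS]].
  (* With no edge kept, one colour is still required, since an endpoint of [e0] is a vertex. *)
  rewrite addn1 ltnS lt0n; apply/eqP => h0.
  have := leqnn (chromatic_number (spanning_subgraph (set0 : {set {set G}}))).
  rewrite [X in (_ <= X)%N]h0 => /chromatic_number_leP[f [f0 _]].
  by case/edgesP: e0E => x _; have := f0 x.
rewrite /= addn0; apply: (@chromatic_number_edge (spanning_subgraph S) e).
apply/edgesP.
have /edgesP[x [y [xy exy]]] := subsetP SE e eS.
by exists x, y; split=> //; rewrite /= /sub_adj xy -exy.
Qed.

End Expectation.

(** * Graphs with many critical edges *)

Record fragile (k : nat) (G : sgraph) (F : {set {set G}}) : Prop := Fragile {
  fragile_chi : chromatic_number G = k.+1;
  fragile_sub : F \subset edges G;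
  fragile_col : forall e, e \in F ->
    rel_colorable (fun x y : G => adj x y && ([set x; y] != e)) k }.
Arguments fragile k {G} F.

Lemma expected_chi_fragile (R : realType) (p : R) (k : nat) (G : sgraph)
    (F : {set {set G}}) : 0 <= p <= 1 -> fragile k F ->
  expected_chi p G <= k%:R + p ^+ #|F|.
Proof.
(* Negation turns the upper bound into the lower-bound form of [ler_expectation_Gp]; pointwise, the
   chromatic number is at most [k], plus 1 if all of [F] is kept. *)
move=> p01 [chiG FE Fcol]; rewrite -kept_prob_contains // -lerN2 opprD -!sumrN.
under eq_bigr => S _ do rewrite -mulrN.
under [leRHS]eq_bigr => S _ do rewrite -mulrN.
apply: ler_expectation_Gp => // S _; rewrite -opprD lerN2 -natrD ler_nat.
case: (boolP (F \subset S)) => [_|/subsetPn[e eF eS]].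
  rewrite addn1 -chiG; apply/chromatic_number_leP.
  have /chromatic_number_leP := leqnn (chromatic_number G).
  by apply: rel_colorable_sub => x y /andP[].
rewrite addn0; apply/chromatic_number_leP; apply: rel_colorable_sub (Fcol e eF).
move=> x y /andP[xy xyS]; rewrite xy /=.
by apply: contraTneq xyS => ->.
Qed.

(** * Cones: adding an apex raises the chromatic number by one *)

Section Cone.
Variable G : sgraph.

Definition cone_adj (u v : option G) : bool :=
  match u, v with
  | Some x, Some y => adj x y
  | None, None => false
  | _, _ => true
  end.

Lemma cone_adj_sym : symmetric cone_adj.
Proof. by case=> [x|] [y|] //=; apply: adj_sym. Qed.

Lemma cone_adj_irr : irreflexive cone_adj.
Proof. by case=> [x|] //=; apply: adj_irr. Qed.

Definition cone : sgraph := SGraph cone_adj_sym cone_adj_irr.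

End Cone.

(** The apex colour occurs nowhere else, so [unbump] can close the gap it leaves in the palette. *)
Lemma cone_colorable (G : sgraph) (k : nat) :
  rel_colorable (@adj (cone G)) k.+1 -> rel_colorable (@adj G) k.
Proof.
case=> f [fk fP]; exists (fun x => unbump (f None) (f (Some x))).
split=> [x|x y xy].
  have : f None != f (Some x) by apply: fP.
  by move: (fk None) (fk (Some x)); rewrite /unbump; case: ltnP => /=; lia.
have nx z : f (Some z) \in predC1 (f None) by rewrite inE /= fP.
apply: contraNneq (fP (Some x) (Some y) xy) => /(congr1 (bump (f None))).
by rewrite !unbumpK // => ->.
Qed.

(** The apex gets the new colour [k]. A general [r] covers both the cone and the cone with an edge
    deleted. *)
Lemma colorable_cone (G : sgraph) (r : rel (cone G)) (k : nat) :
  irreflexive r ->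
  rel_colorable (fun x y : G => r (Some x) (Some y)) k -> rel_colorable r k.+1.
Proof.
move=> rI [f [fk fP]]; exists (oapp f k); split=> [[x|]|] //=.
  by rewrite ltnS ltnW.
case=> [x|] [y|] => [/fP||| ] //=; last by rewrite rI.
- by have := fk x; lia.
- by have := fk y; lia.
Qed.

Lemma fragile_cone (k : nat) (G : sgraph) (F : {set {set G}}) : fragile k F ->
  fragile k.+1 (G := cone G) [set Some @: (e : {set G}) | e in F].
Proof.
move=> [chiG FE Fcol].
have SomeE (x y : G) : Some @: [set x; y] = [set Some x; Some y].
  by rewrite imsetU !imset_set1.
split.
- apply/eqP; rewrite eqn_leq; apply/andP; split.
    apply/chromatic_number_leP/colorable_cone; first exact: adj_irr.
    by apply/chromatic_number_leP; rewrite chiG.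
  rewrite ltnNge; apply/negP => /chromatic_number_leP/cone_colorable.
  by move/chromatic_number_leP; rewrite chiG ltnn.
- apply/subsetP => _ /imsetP[e /(subsetP FE)/edgesP[x [y [xy ->]]] ->].
  by rewrite SomeE; apply: (@mem_edges (cone G)).
- move=> _ /imsetP[e eF ->]; apply: colorable_cone => [x|].
    by rewrite adj_irr.
  apply: rel_colorable_sub (Fcol e eF) => x y /= /andP[-> xye] /=.
  by apply: contra xye => /eqP <-; rewrite SomeE.
Qed.

(** * Odd cycles and their critical edges *)

Section OddCycle.
Variable n : nat.

Definition cycle_adj (i j : 'I_(n.*2.+3)) : bool :=
  [|| i.+1 == j, j.+1 == i, (i == 0 :> nat) && (j == n.*2.+2 :> nat)
    | (j == 0 :> nat) && (i == n.*2.+2 :> nat)].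

Lemma cycle_adj_sym : symmetric cycle_adj.
Proof. by move=> i j; rewrite /cycle_adj; lia. Qed.

Lemma cycle_adj_irr : irreflexive cycle_adj.
Proof. by move=> i; rewrite /cycle_adj; lia. Qed.

Definition odd_cycle : sgraph := SGraph cycle_adj_sym cycle_adj_irr.

(** These are the path edges, all edges but the closing one between [0] and [n.*2.+2]. *)
Definition cycle_edge (i : 'I_(n.*2.+2)) : {set odd_cycle} :=
  [set widen_ord (leqnSn _) i; lift ord0 i].

Lemma cycle_edge_inj : injective cycle_edge.
Proof.
move=> i j /setP eij; apply: val_inj => /=.
move: (eij (widen_ord (leqnSn _) i)) (eij (lift ord0 i)).
rewrite !inE !eqxx orbT /= -!(inj_eq val_inj) /= /bump /=; lia.
Qed.

(** Two colours must alternate along the path, so its ends, at even distance, agree although the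
    closing edge joins them. *)
Lemma odd_cycle_not2 : ~ rel_colorable (@adj odd_cycle) 2.
Proof.
case=> f [f2 fP].
have alt i : (i < n.*2.+3)%N -> f (inord i) = ((f ord0 + i) %% 2)%N.
  elim: i => [_|i IH lti].
    by rewrite addn0 modn_small //; congr f; apply: val_inj; rewrite /= inordK.
  have /fP : cycle_adj (inord i) (inord i.+1).
    by rewrite /cycle_adj !inordK ?eqxx // ltnW.
  rewrite IH ?(ltnW lti) //; have := f2 (inord i.+1); lia.
have /fP : cycle_adj ord0 (inord n.*2.+2).
  by rewrite /cycle_adj inordK //=; lia.
by rewrite alt //; have := f2 ord0; lia.
Qed.

Lemma fragile_odd_cycle : fragile 2 (G := odd_cycle) (cycle_edge @: setT).
Proof.
split.
- apply/eqP; rewrite eqn_leq; apply/andP; split.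
    apply/chromatic_number_leP.
    exists (fun i => if i == ord_max then 2%N else odd i); split=> [i|i j].
      by case: ifP => // _; case: odd.
    rewrite /= /cycle_adj -!(inj_eq val_inj) /=.
    by have := ltn_ord i; have := ltn_ord j; do 2!case: ifP; lia.
  by rewrite ltnNge; apply/negP => /chromatic_number_leP/odd_cycle_not2.
- apply/subsetP => _ /imsetP[i _ ->]; apply: (@mem_edges odd_cycle).
  by rewrite /= /cycle_adj /= eqxx.
- move=> _ /imsetP[a _ ->].
  (* Parity, flipped beyond the deleted edge: only its endpoints clash, and the flip separates the
     ends of the closing edge. *)
  exists (fun i : odd_cycle => nat_of_bool (odd i (+) (a < i)%N)).
  split=> [i|i j]; first by case: (_ (+) _).
  have edge_a (u v : odd_cycle) : a = u :> nat -> u.+1 = v ->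
      [set u; v] = cycle_edge a.
    by move=> au uv; congr [set _; _]; apply: val_inj; rewrite /= ?/bump; lia.
  move=> /andP[/or4P[] /= h ne].
  + have : a != i :> nat.
      by apply: contraNneq ne => /edge_a ->; rewrite ?(eqP h).
    by move/eqP: h => <- /=; lia.
  + have : a != j :> nat.
      by apply: contraNneq ne => /edge_a; rewrite setUC => ->; rewrite ?(eqP h).
    by move/eqP: h => <- /=; lia.
  + by case/andP: h => /eqP-> /eqP->; have := ltn_ord a; lia.
  + by case/andP: h => /eqP-> /eqP->; have := ltn_ord a; lia.
Qed.

End OddCycle.

Definition K2 : sgraph :=
  @SGraph bool (fun x y => x != y) (fun x y => congr1 negb (eq_sym x y))
    (fun x => congr1 negb (eqxx x)).

Lemma fragile_K2 : fragile 1 (G := K2) [set [set: K2]].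
Proof.
have edgeT (x y : K2) : adj x y -> [set x; y] = setT.
  by move=> xy; apply/setP; move: x y xy => [] [] // _ []; rewrite !inE.
have ET : [set: K2] \in edges K2.
  by rewrite -(edgeT true false) //; apply: (@mem_edges K2).
split; last 2 first.
- by rewrite sub1set.
- move=> e /set1P ->; exists (fun=> 0%N); split=> // x y /andP[/edgeT ->].
  by rewrite eqxx.
apply/eqP; rewrite eqn_leq (chromatic_number_edge ET) andbT.
apply/chromatic_number_leP.
by exists (fun b : bool => b : nat); split=> [[]|[] []].
Qed.

(** * Choice of the comparison graph *)

Lemma exists_fragile (k M : nat) : exists (G : sgraph) (F : {set {set G}}),
  fragile k.+2 F /\ (M <= #|F|)%N.
Proof.
elim: k => [|k [G [F [fF MF]]]].
  exists (odd_cycle M), (@cycle_edge M @: setT).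
  split; first exact: fragile_odd_cycle.
  rewrite card_imset ?cardsT ?card_ord; last exact: cycle_edge_inj.
  by rewrite -addnn; lia.
exists (cone G), [set Some @: (e : {set G}) | e in F].
split; first exact: fragile_cone.
by rewrite card_imset //; apply/imset_inj/Some_inj.
Qed.

Lemma exists_expr_lt (R : realType) (p d : R) : 0 <= p < 1 -> 0 < d ->
  exists M, p ^+ M < d.
Proof.
move=> /andP[p0 p1] d0.
(* A Bernoulli-type inequality: [p ^+ n] decays at least like 1/(n(1-p)). *)
have bernoulli n : p ^+ n * (1 + n%:R * (1 - p)) <= 1.
  elim: n => [|n IH]; first by rewrite expr0 mul0r addr0 mulr1.
  apply: le_trans IH; rewrite exprSr -mulrA ler_wpM2l ?exprn_ge0 //.
  have : 0 <= n%:R * (1 - p) ^+ 2 :> R by rewrite mulr_ge0 // sqr_ge0.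
  have : 0 <= (1 - p) ^+ 2 by rewrite sqr_ge0.
  by rewrite -natr1; nra.
have q0 : 0 < 1 - p by rewrite subr_gt0.
(* This makes [M%:R * (1 - p) * d] exceed 1, so [d <= p ^+ M] would contradict [bernoulli]. *)
exists (Num.bound (d * (1 - p))^-1); set M := Num.bound _.
have : (d * (1 - p))^-1 < M%:R.
  by apply: archi_boundP; rewrite invr_ge0 mulr_ge0 // ltW.
rewrite -[X in X < _]mul1r ltr_pdivrMr ?mulr_gt0 // => Md.
rewrite ltNge; apply/negP => dM.
have := bernoulli M; rewrite leNgt => /negP; apply.
apply: lt_le_trans Md _; rewrite mulrCA.
have : 0 <= M%:R * (1 - p) :> R by rewrite mulr_ge0 // ltW.
by nra.
Qed.

Theorem theorem3 (R : realType) (H : sgraph) (p : R)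
  (hE : (1 < #|edges H|)%N)
  (hp0 : 1 - 1 / #|edges H|%:R < p) (hp1 : p < 1) :
  exists G : sgraph,
    chromatic_number G = chromatic_number H /\
    expected_chi p H > expected_chi p G.
Proof.
have m0 : 0 < #|edges H|%:R :> R by rewrite ltr0n ltnW.
(* The hypothesis on [p] says that fewer than one edge is deleted on average. *)
have mp : #|edges H|%:R * (1 - p) < 1.
  by rewrite mulrC -ltr_pdivlMr // ltrBlDr addrC -ltrBlDr.
have p0 : 0 < p.
  apply: le_lt_trans hp0; rewrite subr_ge0 ler_pdivrMr // mul1r.
  by rewrite ler1n ltnW.
have p01 : 0 <= p <= 1 by rewrite !ltW.
have [e0 e0E] : exists e, e \in edges H by apply/card_gt0P; apply: ltnW.
have := chromatic_number_edge e0E.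
case chiH: (chromatic_number H) => [|[|[|k]]] // _.
- exists K2; split; first exact: fragile_chi fragile_K2.
  apply: le_lt_trans (expected_chi_fragile p01 fragile_K2) _.
  apply: lt_le_trans (expected_chi_ge_edgeless p01 (ltnW hE)).
  have : (1 - p) ^+ #|edges H| < 1 - p.
    by rewrite -[ltRHS]expr1 ltr_iXn2l ?subr_gt0 // ltrBlDr ltrDl.
  by rewrite cards1 expr1; move: (_ ^+ #|edges H|) => x; clear -R; lra.
(* The right-hand side is the margin by which the lower bound for [H] exceeds [k.+2]. *)
- have [M pM] : exists M, p ^+ M < 1 - #|edges H|%:R * (1 - p).
    by apply: exists_expr_lt; rewrite ?subr_gt0 // ltW.
  have [G [F [fF MF]]] := exists_fragile k M.
  exists G; split; first exact: fragile_chi fF.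
  apply: le_lt_trans (expected_chi_fragile p01 fF) _.
  apply: lt_le_trans (expected_chi_ge_deleted H p01).
  have pFM : p ^+ #|F| <= p ^+ M by rewrite ler_wiXn2l // ltW.
  rewrite chiH -(natr1 k.+2); move: (k.+2%:R) => c; rewrite -addrA ltrD2l.
  exact: le_lt_trans pFM pM.
Qed.
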